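(* Suppose that $\mathcal{P}_0$ is algebraic, $\overline{\mathrm{int}(\tilde\Delta_{k-1})\cap\mathcal{P}_0}=\mathcal{P}_0$, and $I_{\mathbb{R}^{k-1}}(\mathcal{P}_0)=\langle f\rangle$ is a principal ideal generated by a single polynomial $f\in\mathbb{R}[\pi_1,\dots,\pi_{k-1}]$. Suppose that $\nabla f$ is non-zero at every point of $\mathcal{P}_0$. Then: (a) The NTUB and SUB unbiasedness thresholds of $\mathcal{P}_0$ are both equal to $2\deg(f)$. (b) Let $0<\alpha<1$ and $n=2\deg(f)$. There is a unique uniformly most powerful test among the size-$\alpha$ NTUB tests, and it is also the unique uniformly most powerful test among the size-$\alpha$ SUB tests. Its power function has the form $\beta=c_\alpha f^2+\alpha$, where $c_\alpha\in(0,\infty)$ is the largest constant that makes $\beta$ a power polynomial. Every size-$\alpha$ NTUB test of $\mathcal{P}_0$ for this $n$ has a power function of the form $cf^2+\alpha$ with $c\in(0,c_\alpha]$. (c) More generally, if $\beta$ is the power function of a size-$\alpha$ NTUB test for a sample size $n$, then there exists a polynomial $h\in\mathbb{R}[\pi_1,\dots,\pi_k]$ of degree $n-2\deg(f)$, non-negative on $\Delta_{k-1}$, such that $\beta=f^2h+\alpha$ on $\Delta_{k-1}$. If the test is SUB then $h$ must in addition be strictly positive on $\mathcal{P}_A$.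
   Context: Fix $k\ge2$, $\Delta_{k-1}=\{\boldsymbol\pi\in\mathbb{R}^k:\pi_i\ge0,\sum_i\pi_i=1\}$, identified with $\tilde\Delta_{k-1}=\{\boldsymbol\pi\in\mathbb{R}^{k-1}:\pi_i\ge0,\sum_{i<k}\pi_i\le1\}$ via the first $k-1$ coordinates ($\pi_k=1-\sum_{i<k}\pi_i$). The null hypothesis $\mathcal{P}_0$ is a nonempty proper subset of the simplex and $\mathcal{P}_A$ is its complement in the simplex. $\mathcal{P}_0$ is algebraic if it is the set of points of the simplex at which finitely many given real polynomials all vanish. $I_{\mathbb{R}^{k-1}}(\mathcal{P}_0)$ is the ideal of polynomials in $\mathbb{R}[\pi_1,\dots,\pi_{k-1}]$ vanishing on $\mathcal{P}_0$ (viewed in $\mathbb{R}^{k-1}$). Interior and closure are Euclidean in $\mathbb{R}^{k-1}$. On $\Delta_{k-1}$, $f$ is evaluated at the first $k-1$ coordinates. Data: $\mathbf X\sim\text{Multinomial}_k(\boldsymbol\pi,n)$, $n$ the sample size. A (randomized) test for sample size $n$ is a function $\phi:\{\mathbf x\in\mathbb{N}^k:\sum x_i=n\}\to[0,1]$, with power function $\beta_\phi(\boldsymbol\pi)=\sum_{\mathbf x}\phi(\mathbf x)\frac{n!}{x_1!\cdots x_k!}\prod_i\pi_i^{x_i}$ on $\Delta_{k-1}$. A function on $\Delta_{k-1}$ is a power polynomial (for sample size $n$) if it is the power function of some test for sample size $n$. The size of $\phi$ is $\sup_{\boldsymbol\pi\in\mathcal{P}_0}\beta_\phi(\boldsymbol\pi)$.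 $\phi$ is unbiased if $\beta_\phi(\boldsymbol\pi_0)\le\beta_\phi(\boldsymbol\pi_A)$ for all $\boldsymbol\pi_0\in\mathcal{P}_0,\boldsymbol\pi_A\in\mathcal{P}_A$; NTUB (non-trivial unbiased) if unbiased with $\beta_\phi$ non-constant; SUB (strictly unbiased) if the inequality is strict for all such pairs. A test is uniformly most powerful within a class of tests if it belongs to the class and its power at every point of $\mathcal{P}_A$ is at least that of every other test in the class. The NTUB (SUB) unbiasedness threshold is the minimum sample size $n$ for which an NTUB (SUB) test exists ($\infty$ if none exists). *)

(* Defs.v *)
From mathcomp Require Import all_boot all_order all_algebra.
From mathcomp Require Import all_classical reals topology normedtype.
(* The notations of mpoly clash with those of MathComp-Analysis, so
   [mpoly n R], [meval], [mderiv] and [msize] are written out. *)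
From mathcomp Require mpoly.
Import -(notations) mpoly.
Set Implicit Arguments.
Unset Strict Implicit.
Unset Printing Implicit Defensive.
Import Order.TTheory GRing.Theory Num.Theory.
Import numFieldNormedType.Exports.
Local Open Scope classical_set_scope.
Local Open Scope ring_scope.

(* [msize p] is 1 plus the total degree of p; the zero polynomial gets
   degree 0. *)
Definition deg (n : nat) (R : nzRingType) (p : mpoly n R) : nat := (msize p).-1.

Definition evalv (R : realType) (n : nat) (p : mpoly n R) (x : 'rV[R]_n) : R :=
  meval (fun i => x 0 i) p.

Definition grad (R : realType) (n : nat) (p : mpoly n R) (x : 'rV[R]_n) :
    'rV[R]_n :=
  \row_i evalv (mderiv i p) x.

Definition vanishing_ideal (R : realType) (n : nat) (V : set 'rV[R]_n) :
    set (mpoly n R) :=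
  [set p | forall x, V x -> evalv p x = 0].

Definition principal_ideal (n : nat) (R : comNzRingType) (f : mpoly n R) :
    set (mpoly n R) :=
  [set q * f | q in [set: mpoly n R]].

Definition simplex (R : realType) (k : nat) : set 'rV[R]_k :=
  [set x | (forall i, 0 <= x 0 i) /\ \sum_i x 0 i = 1].
Arguments simplex : clear implicits.

Definition flat_simplex (R : realType) (m : nat) : set 'rV[R]_m :=
  [set y | (forall i, 0 <= y 0 i) /\ \sum_i y 0 i <= 1].
Arguments flat_simplex : clear implicits.

Definition drop_last (R : realType) (k : nat) (x : 'rV[R]_k) : 'rV[R]_k.-1 :=
  \row_(i < k.-1) x 0 (widen_ord (leq_pred k) i).

Definition algebraic (R : realType) (k : nat) (P0 : set 'rV[R]_k) : Prop :=
  exists s : seq (mpoly k R),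
    P0 = [set x | simplex R k x /\ forall p, p \in s -> evalv p x = 0].

Definition alternative (R : realType) (k : nat) (P0 : set 'rV[R]_k) :
    set 'rV[R]_k :=
  simplex R k `\` P0.

(* The set {x in N^k : sum_i x_i = n}; its points have coordinates at most n,
   which makes it a finite type. *)
Definition sample (k n : nat) : Type :=
  {x : {ffun 'I_k -> 'I_n.+1} | (\sum_i (x i : nat) == n)%N}.

Definition test (R : realType) (k n : nat) : Type :=
  {phi : {ffun sample k n -> R} | [forall x, 0 <= phi x <= 1]}.

Definition multinomial_pmf (R : realType) (k n : nat) (p : 'rV[R]_k)
    (x : sample k n) : R :=
  (n`!)%:R / \prod_i ((val x i)`!)%:R * \prod_i p 0 i ^+ val x i.

Definition power (R : realType) (k n : nat) (phi : test R k n)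
    (p : 'rV[R]_k) : R :=
  \sum_x val phi x * multinomial_pmf p x.

Definition power_polynomial (R : realType) (k n : nat) (b : 'rV[R]_k -> R) :
    Prop :=
  exists phi : test R k n, forall p, simplex R k p -> b p = power phi p.

Definition size_of (R : realType) (k n : nat) (P0 : set 'rV[R]_k)
    (phi : test R k n) : R :=
  sup [set power phi p | p in P0].

Definition unbiased (R : realType) (k n : nat) (P0 : set 'rV[R]_k)
    (phi : test R k n) : Prop :=
  forall p0 pA, P0 p0 -> alternative P0 pA -> power phi p0 <= power phi pA.

Definition NTUB (R : realType) (k n : nat) (P0 : set 'rV[R]_k) :
    set (test R k n) :=
  [set phi | unbiased P0 phi /\
     ~ exists c, forall p, simplex R k p -> power phi p = c].

Definition SUB (R : realType) (k n : nat) (P0 : set 'rV[R]_k) :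
    set (test R k n) :=
  [set phi | forall p0 pA, P0 p0 -> alternative P0 pA ->
     power phi p0 < power phi pA].

Definition of_size (R : realType) (k n : nat) (P0 : set 'rV[R]_k) (a : R) :
    set (test R k n) :=
  [set phi | size_of P0 phi = a].

Definition UMP (R : realType) (k n : nat) (P0 : set 'rV[R]_k)
    (C : set (test R k n)) : set (test R k n) :=
  [set phi | C phi /\ forall psi, C psi -> forall p, alternative P0 p ->
     power psi p <= power phi p].

(* The least n satisfying P; None stands for infinity. *)
Definition min_sample_size (P : nat -> Prop) : option nat :=
  match pselect (exists n, `[< P n >]) with
  | left exP => Some (ex_minn exP)
  | right _ => None
  end.

Definition NTUB_threshold (R : realType) (k : nat) (P0 : set 'rV[R]_k) :
    option nat :=
  min_sample_size (fun n => exists phi : test R k n, NTUB P0 phi).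

Definition SUB_threshold (R : realType) (k : nat) (P0 : set 'rV[R]_k) :
    option nat :=
  min_sample_size (fun n => exists phi : test R k n, SUB P0 phi).

(* Main.v *)
(** Every point of [P0] is a limit of points of the alternative, so the power of
    an unbiased test is constant on [P0]; minus its size it is a polynomial
    vanishing on [P0], hence a multiple [q * f]. At a point of [P0] interior to
    the simplex this difference is minimal, so its gradient [q * grad f]
    vanishes there; as [grad f] does not, [q] vanishes on [P0] by density, and
    [f ^ 2] divides the difference. Conversely, the Bernstein coefficients of
    [c * f ^ 2 + a] are affine in [c] and equal to [a] at [c = 0], so they lie in
    [0, 1] for small [c]. Uniqueness of Bernstein coefficients gives the rest. *)

Require Import Defs.
From mathcomp Require Import all_boot all_order all_algebra.
From mathcomp Require Import all_classical reals topology normedtype.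
From mathcomp Require mpoly.
From mathcomp Require Import lra ring.
Import -(notations) mpoly.
Set Implicit Arguments.
Unset Strict Implicit.
Unset Printing Implicit Defensive.
Import Order.TTheory GRing.Theory Num.Theory.
Import numFieldNormedType.Exports.
Local Open Scope classical_set_scope.
Local Open Scope ring_scope.

Lemma min_sample_size_eq (P : nat -> Prop) (n : nat) :
  P n -> (forall j, P j -> (n <= j)%N) -> min_sample_size P = Some n.
Proof.
move=> Pn minn; rewrite /min_sample_size; case: pselect => [exP|[]]; last first.
  by exists n; apply/asboolP.
congr Some; case: ex_minnP => i /asboolP Pi mini; apply/eqP.
by rewrite eqn_leq mini ?minn //; apply/asboolP.
Qed.

(** * Univariate polynomials near 0 *)

(** A negative value at 0 would persist: [g] differs from [g.[0]] by [q * 'X], and [q] is bounded on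
    the unit disk. *)
Lemma horner0_ge0 (R : realFieldType) (g : {poly R}) :
  (forall e, 0 < e -> exists2 t, 0 < t < e & 0 <= g.[t]) -> 0 <= g.[0].
Proof.
move=> gP; rewrite leNgt; apply/negP => g0_lt0.
have [q gE] : exists q, g = g.[0]%:P + q * 'X.
  have /factor_theorem[q qE] : root (g - g.[0]%:P) 0.
    by rewrite /root !hornerE subrr.
  by exists q; rewrite subr0 in qE; rewrite -qE addrC subrK.
have [b ub] := poly_disk_bound q 1.
have b_ge0 : 0 <= b by apply: le_trans (ub 0 _); rewrite ?normr0.
(* For [0 < t < e] the bound [b] applies to [q.[t]], and [(b + 1) * t < - g.[0]]. *)
pose e := Num.min 1 (- g.[0] / (b + 1)).
have [t /andP[t0]] : exists2 t, 0 < t < e & 0 <= g.[t].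
  by apply: gP; rewrite lt_min ltr01 divr_gt0 // ?oppr_gt0 // ltr_wpDl.
rewrite lt_min ltr_pdivlMr ?ltr_wpDl // => /andP[t1 tb].
rewrite gE !hornerE /= => g0; have qb : q.[t] <= b.
  by rewrite (le_trans (ler_norm _)) // ub // ger0_norm ltW.
have : q.[t] * t <= b * t by rewrite ler_wpM2r // ltW.
lra.
Qed.

Lemma exists_nonroot (R : realFieldType) (u : {poly R}) (e : R) :
  u != 0 -> 0 < e -> exists2 t, 0 < t < e & u.[t] != 0.
Proof.
(* The points e/2, e/3, ... number [size u], one more than the degree, so they cannot all be
   roots. *)
move=> u0 e0; pose s := [seq e / i.+2%:R | i <- iota 0 (size u)].
case: (boolP (all (root u) s)) => [sr|].
  suff /(max_poly_roots u0 sr) : uniq s by rewrite size_map size_iota ltnn.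
  rewrite map_inj_uniq ?iota_uniq // => i j /(mulfI (lt0r_neq0 e0)) /invr_inj.
  by move/eqP; rewrite eqr_nat => /eqP[].
case/allPn => _ /mapP[i _ ->] ri; exists (e / i.+2%:R) => //.
by rewrite divr_gt0 ?ltr0n //= ltr_pdivrMr ?ltr0n // ltr_pMr // ltr1n.
Qed.

(** Finitely many roots of [u] cannot block the approach to 0. Later [u] is [f] along a segment, and
    its nonroots are parameters of points of the alternative. *)
Lemma horner0_ge0_off_roots (R : realFieldType) (g u : {poly R}) : u != 0 ->
  (forall t, 0 < t <= 1 -> u.[t] != 0 -> 0 <= g.[t]) -> 0 <= g.[0].
Proof.
move=> u0 gP; apply: horner0_ge0 => e e0.
have [|t /andP[t0]] := @exists_nonroot _ u (Num.min 1 e) u0.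
  by rewrite lt_min ltr01.
rewrite lt_min => /andP[t1 te] ut; exists t; first by rewrite t0.
by apply: gP; rewrite ?t0 ?ltW.
Qed.

(** Write [u = r * 'X], so that the derivative at 0 is [r.[0]]. Nonnegativity of [u] makes [r]
    nonnegative to the right of 0 and nonpositive to the left. *)
Lemma deriv0_local_min (R : realFieldType) (u : {poly R}) (e : R) : 0 < e ->
  u.[0] = 0 -> (forall t, `|t| < e -> 0 <= u.[t]) -> u^`().[0] = 0.
Proof.
move=> e0 u0 uP; have /factor_theorem[r] : root u 0 by apply/rootP.
rewrite subr0 => uE; have -> : u^`().[0] = r.[0].
  by rewrite uE derivM derivX mulr1 hornerD hornerMX mulr0 add0r.
have ut (t : R) : u.[t] = r.[t] * t by rewrite uE hornerMX.
have near0 (g : {poly R}) :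
    (forall t, 0 < t -> t < e -> 0 <= g.[t]) -> 0 <= g.[0].
  move=> gP; apply: horner0_ge0 => d d0; pose t := Num.min e d / 2.
  have t0 : 0 < t by rewrite divr_gt0 // lt_min e0.
  have /andP[te td] : (t < e) && (t < d).
    by rewrite -lt_min ltr_pdivrMr // ltr_pMr ?ltr1n // lt_min e0.
  by exists t; [rewrite t0|apply: gP].
apply/eqP; rewrite eq_le -oppr_ge0; apply/andP; split.
  (* The left side is reduced to the right side by the reflection of [t] to [- t]. *)
  rewrite (_ : - r.[0] = (- (r \Po - 'X)).[0]); last first.
    by rewrite hornerN horner_comp hornerN hornerX oppr0.
  apply: near0 => t t0 te; rewrite hornerN horner_comp hornerN hornerX.
  have := uP (- t); rewrite normrN gtr0_norm // => /(_ te).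
  by rewrite ut mulrN -mulNr pmulr_lge0.
apply: near0 => t t0 te.
by have := uP t; rewrite gtr0_norm // => /(_ te); rewrite ut pmulr_lge0.
Qed.

(** * Multivariate polynomials along lines *)

(** Constants and variables generate the ring, so a property stable under sums and products needs no
    monomial expansion. *)
Lemma mpoly_ring_ind (n : nat) (R : comNzRingType) (P : mpoly n R -> Prop) :
  (forall c, P (mpolyC n c)) -> (forall i, P (mpolyX R (mnm1 i))) ->
  (forall p q, P p -> P q -> P (p + q)) ->
  (forall p q, P p -> P q -> P (p * q)) -> forall p, P p.
Proof.
move=> PC PX PD PM p; rewrite [p]mpolyE.
apply: (big_ind P) => [|//|m _]; first by rewrite -mpolyC0.
rewrite -mul_mpolyC; apply: (PM) => //; rewrite mpolyXE_id.
have P1 : P 1 by rewrite -mpolyC1.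
apply: (big_ind P) => // i _; elim: (m i) => [|e IH]; first by rewrite expr0.
by rewrite exprS; apply: PM.
Qed.

Definition along (R : realType) (n : nat) (v w : 'rV[R]_n) (p : mpoly n R) :
    {poly R} :=
  mmap (@polyC R) (fun i => (v 0 i)%:P + (w 0 i)%:P * 'X) p.

Lemma horner_along (R : realType) (n : nat) (v w : 'rV[R]_n) p (t : R) :
  (along v w p).[t] = evalv p (v + t *: w).
Proof.
rewrite /evalv mevalE /along /mmap horner_sum; apply: eq_bigr => m _.
rewrite hornerM hornerC /mmap1 horner_prod; congr (_ * _).
by apply: eq_bigr => i _; rewrite horner_exp !hornerE !mxE mulrC.
Qed.

(** Both sides are derivations relative to evaluation at [v], and they agree on constants and
    variables. *)
Lemma deriv_along (R : realType) (n : nat) (v : 'rV[R]_n) p i :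
  (along v (delta_mx 0 i) p)^`().[0] = evalv (mderiv i p) v.
Proof.
have along0 q : (along v (delta_mx 0 i) q).[0] = meval (fun j => v 0 j) q.
  by rewrite horner_along scale0r addr0.
rewrite /evalv; elim/mpoly_ring_ind: p => [c|j|p q IHp IHq|p q IHp IHq].
- by rewrite mderivC meval0 /along mmapC derivC horner0.
- rewrite /along mmapX mmap1U derivD derivC add0r derivM derivC mul0r add0r.
  rewrite derivX mulr1 hornerC mderivX mevalZ !mxE /= mnm1E eq_sym.
  case: eqP => [->|_] /=; last by rewrite mul0r.
  rewrite (_ : mnm_sub _ _ = mnm0) ?mpolyX0 ?meval1 ?mulr1 //.
  by apply/mnmP => l; rewrite mnmBE subnn mnm0E.
- by rewrite mderivD mevalD -IHp -IHq /along mmapD derivD hornerD.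
- rewrite mderivM mevalD !mevalM -IHp -IHq -!along0.
  by rewrite /along rmorphM derivM hornerD !hornerM.
Qed.

Lemma evalv_continuous (R : realType) (n : nat) (p : mpoly n R) :
  continuous (evalv p).
Proof.
elim/mpoly_ring_ind: p => [c|j|p q IHp IHq|p q IHp IHq] x.
- rewrite (_ : evalv _ = fun=> c); first exact: cst_continuous.
  by apply/funext => y; rewrite /evalv mevalC.
- rewrite (_ : evalv _ = fun y => y 0 j); first exact: coord_continuous.
  by apply/funext => y; rewrite /evalv mevalXU.
- rewrite (_ : evalv _ = evalv p \+ evalv q); first exact: cvgD (IHp x) (IHq x).
  by apply/funext => y; rewrite /evalv mevalD.
- rewrite (_ : evalv _ = evalv p \* evalv q); first exact: cvgM (IHp x) (IHq x).
  by apply/funext => y; rewrite /evalv mevalM.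
Qed.

(** * Bernstein coefficients and the multinomial theorem *)

Definition mono (k n : nat) (x : sample k n) : multinom k :=
  Multinom [tuple (val x i : nat) | i < k].

(** The multinomial coefficient, taken in the field. *)
Definition mult (R : realType) (k n : nat) (x : sample k n) : R :=
  (n`!)%:R / \prod_i ((val x i)`!)%:R.
Arguments mult : clear implicits.

(** For [p] homogeneous of degree [n], the coordinates of [p] in the basis of multinomial
    probabilities. For a power function they are the values of the test. *)
Definition bernstein (R : realType) (k n : nat) (p : mpoly k R)
    (x : sample k n) : R :=
  mcoeff (mono x) p / mult R k n x.

Lemma monoE k n (x : sample k n) i : mono x i = val x i :> nat.
Proof. by rewrite /mono mnmE. Qed.

Lemma mono_inj k n : injective (@mono k n).
Proof.
move=> x y xy; apply: val_inj; apply/ffunP => i; apply: val_inj.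
by rewrite /= -!monoE xy.
Qed.

Lemma mdeg_mono k n (x : sample k n) : mdeg (mono x) = n.
Proof.
rewrite mdegE; apply: etrans (eqP (valP x)).
by apply: eq_bigr => i _; rewrite monoE.
Qed.

Lemma mono_surj k n (m : multinom k) : mdeg m = n ->
  exists x : sample k n, mono x = m.
Proof.
move=> mn; pose g : {ffun 'I_k -> 'I_n.+1} := [ffun i => inord (m i)].
have gE i : g i = m i :> nat.
  by rewrite ffunE inordK // ltnS -mn mdegE (bigD1 i) //= leq_addr.
have gP : (\sum_i (g i : nat) == n)%N.
  by apply/eqP; rewrite -[RHS]mn mdegE; apply: eq_bigr.
exists (exist _ g gP : sample k n).
by apply/mnmP => i; rewrite monoE; exact: gE.
Qed.

Lemma mult_gt0 (R : realType) k n (x : sample k n) : 0 < mult R k n x.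
Proof.
rewrite divr_gt0 ?ltr0n ?fact_gt0 //.
by rewrite prodr_gt0 // => i _; rewrite ltr0n fact_gt0.
Qed.

Lemma multinomial_pmfE (R : realType) k n (v : 'rV[R]_k) (x : sample k n) :
  multinomial_pmf v x = mult R k n x * \prod_i v 0 i ^+ mono x i.
Proof. by congr (_ * _); apply: eq_bigr => i _; rewrite monoE. Qed.

Lemma evalv_bernstein (R : realType) k n (p : mpoly k R) (v : 'rV[R]_k) :
  {in msupp p, forall m, mdeg m = n} ->
  evalv p v = \sum_x bernstein p x * @multinomial_pmf R k n v x.
Proof.
move=> pn; rewrite /evalv mevalE.
rewrite [RHS](eq_bigr (fun x => mcoeff (mono x) p * \prod_i v 0 i ^+ mono x i));
  last first.
  by move=> x _; rewrite multinomial_pmfE mulrA divfK // gt_eqF // mult_gt0.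
(* Samples whose monomial is outside the support contribute 0; [mono] matches the others with the
   support. *)
rewrite [RHS](bigID (fun x => mono x \in msupp p)) /= [X in _ + X]big1 ?addr0;
  last by move=> x /memN_msupp_eq0 ->; rewrite mul0r.
rewrite -(big_map (@mono k n) (fun m => m \in msupp p)
  (fun m => mcoeff m p * \prod_i v 0 i ^+ m i)) -[RHS]big_filter.
apply: perm_big; apply: uniq_perm => [||m].
- exact: msupp_uniq.
- by rewrite filter_uniq // map_inj_uniq ?index_enum_uniq //; exact: mono_inj.
rewrite mem_filter; case mp: (m \in msupp p) => //=; apply/esym/mapP.
by have [x <-] := mono_surj (pn m mp); exists x; rewrite ?mem_index_enum.
Qed.

(** Equal to 1 on the simplex: multiplying by its powers raises the degree without changing values
    there. *)
Definition sum_vars (R : realType) k : mpoly k R := \sum_i mpolyX R (mnm1 i).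
Arguments sum_vars : clear implicits.

Lemma meval_sum_vars (R : realType) k (v : 'I_k -> R) :
  meval v (sum_vars R k) = \sum_i v i.
Proof.
rewrite /sum_vars raddf_sum.
by apply: eq_bigr => i _; rewrite /= mevalXU.
Qed.

Lemma evalv_sum_vars (R : realType) k (v : 'rV[R]_k) :
  simplex R k v -> evalv (sum_vars R k) v = 1.
Proof. by move=> [_ <-]; exact: meval_sum_vars. Qed.

Lemma mderiv_sum_varsX (R : realType) k n i :
  mderiv i (sum_vars R k ^+ n.+1) = n.+1%:R *: sum_vars R k ^+ n.
Proof.
have d1 : mderiv i (sum_vars R k) = 1.
  rewrite /sum_vars raddf_sum (bigD1 i) //= big1 ?addr0 => [|j ji].
    rewrite mderivX mnm1E eqxx scale1r (_ : mnm_sub _ _ = mnm0) ?mpolyX0 //.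
    by apply/mnmP => l; rewrite mnmBE subnn mnm0E.
  by rewrite mderivX mnm1E (negbTE ji) scale0r.
elim: n => [|n IH]; first by rewrite expr1 expr0 d1 scale1r.
rewrite exprS mderivM d1 mul1r IH -scalerAr -exprS.
by rewrite -{1}[_ ^+ _]scale1r -scalerDl -mulrS.
Qed.

(** The multinomial theorem in division-free form. Differentiating in a variable that occurs in [m]
    lowers both [n] and one exponent by one, which drives the induction. *)
Lemma mcoeff_sum_varsX (R : realType) k n (m : multinom k) : mdeg m = n ->
  mcoeff m (sum_vars R k ^+ n) * (\prod_i (m i)`!)%:R = (n`!)%:R.
Proof.
elim: n m => [|n IH] m mn.
  have -> : m = mnm0 by apply/eqP; rewrite -mdeg_eq0 mn.
  by rewrite expr0 mcoeff1 eqxx big1 ?mulr1 // => i _; rewrite mnm0E.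
have [i mi] : exists i, m i != 0%N.
  apply/existsP; apply: contra_eqT mn; rewrite negb_exists => /forallP m0.
  by rewrite mdegE big1 // => i _; exact/eqP/negPn/m0.
have mE : mnm_add (mnm_sub m (mnm1 i)) (mnm1 i) = m.
  by apply: submK; rewrite lep1mP.
set m' := mnm_sub m (mnm1 i) in mE.
have m'n : mdeg m' = n.
  by move: mn; rewrite -mE mdegD mdeg1 addn1 => -[].
have := mcoeff_deriv i m' (sum_vars R k ^+ n.+1).
rewrite mE mderiv_sum_varsX mcoeffZ -[RHS]mulr_natr => dE.
have -> : (\prod_j (m j)`! = (m' i).+1 * \prod_j (m' j)`!)%N.
  rewrite (bigD1 i) //= [in RHS](bigD1 i) //= mulnA; congr (_ * _)%N.
    by rewrite -mE mnmDE mnm1E eqxx addn1 factS.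
  by apply: eq_bigr => j ji; rewrite -mE mnmDE mnm1E eq_sym (negbTE ji) addn0.
by rewrite natrM mulrA -dE -mulrA IH // -natrM -factS.
Qed.

(** Since [sum_vars] is 1 on the simplex, this gives the Bernstein coefficients of the constant 1 in
    degree [n]. *)
Lemma bernstein_sum_varsX (R : realType) k n (x : sample k n) :
  bernstein (sum_vars R k ^+ n) x = 1.
Proof.
have multE : mult R k n x * (\prod_i (mono x i)`!)%:R = (n`!)%:R.
  rewrite /mult natr_prod.
  rewrite [X in _ * X](eq_bigr (fun i => ((val x i)`!)%:R)) => [|i _].
    rewrite divfK //; apply/prodf_neq0 => i _.
    by rewrite pnatr_eq0 -lt0n fact_gt0.
  by rewrite monoE.
rewrite /bernstein (_ : mcoeff _ _ = mult R k n x) ?divff ?gt_eqF ?mult_gt0 //.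
apply: (mulIf _ (etrans (mcoeff_sum_varsX R (mdeg_mono x)) (esym multE))).
by rewrite pnatr_eq0 -lt0n prodn_gt0 // => i; rewrite fact_gt0.
Qed.

(** * Linear independence of the multinomial probabilities *)

Lemma base_expansion_inj (B k : nat) (u v : 'I_k -> nat) :
  (forall i, (u i < B)%N) -> (forall i, (v i < B)%N) ->
  (\sum_i u i * B ^ i = \sum_i v i * B ^ i)%N -> u =1 v.
Proof.
elim: k u v => [|k IH] u v uB vB uv i; first by case: i.
have shift (w : 'I_k.+1 -> nat) : (\sum_i w i * B ^ i =
    (\sum_(i < k) w (lift ord0 i) * B ^ i) * B + w ord0)%N.
  rewrite big_ord_recl expn0 muln1 addnC; congr (_ + _)%N.
  by rewrite big_distrl; apply: eq_bigr => j _; rewrite /= expnSr mulnA.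
move: uv; rewrite !shift => uv.
have B0 : (0 < B)%N by apply: leq_ltn_trans (uB ord0).
have uv0 : u ord0 = v ord0.
  by move/(congr1 (modn^~ B)): uv; rewrite !modnMDl !modn_small.
case: (unliftP ord0 i) => [j|] -> //.
apply: (IH (u \o lift ord0) (v \o lift ord0)) => [l|l|]; rewrite /= ?uB ?vB //.
by move/eqP: uv; rewrite uv0 eqn_add2r eqn_pmul2r // => /eqP.
Qed.

(* Kronecker substitution: at v_i proportional to t^((n+1)^i), distinct
   monomials of degree n become distinct powers of t. *)
Lemma multinomial_pmf_free (R : realType) k n (d : sample k.+1 n -> R) :
  (forall v, simplex R k.+1 v -> \sum_x d x * multinomial_pmf v x = 0) ->
  forall x, d x = 0.
Proof.
move=> d0 y; pose w (x : sample k.+1 n) := (\sum_i val x i * n.+1 ^ i)%N.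
have w_inj : injective w.
  move=> x z /base_expansion_inj xz; apply: val_inj; apply/ffunP => i.
  by apply/val_inj/xz => j; exact: ltn_ord.
pose q : {poly R} := \sum_x (d x * mult R k.+1 n x) *: 'X^(w x).
have qt t : 0 < t -> q.[t] = 0.
  move=> t0; pose s := \sum_(i < k.+1) t ^+ (n.+1 ^ i).
  have s0 : 0 < s.
    rewrite /s big_ord_recl ltr_pwDl ?exprn_gt0 //.
    by apply: sumr_ge0 => i _; rewrite exprn_ge0 // ltW.
  pose v : 'rV[R]_k.+1 := \row_i (t ^+ (n.+1 ^ i) / s).
  have : \sum_x d x * multinomial_pmf v x = 0.
    apply: d0; split=> [i|]; first by rewrite mxE divr_ge0 ?exprn_ge0 ?ltW.
    rewrite (eq_bigr (fun i : 'I_k.+1 => t ^+ (n.+1 ^ i) / s)) => [|i _].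
      by rewrite -mulr_suml divff ?gt_eqF.
    by rewrite mxE.
  (* All monomials have degree [n], so normalising by [s] costs the same factor [s ^+ n] in every
     term. *)
  rewrite (eq_bigr (fun x => (d x * mult R k.+1 n x * t ^+ w x) / s ^+ n)).
    rewrite -mulr_suml => /eqP; rewrite mulf_eq0 invr_eq0 expf_eq0.
    rewrite (gt_eqF s0) andbF orbF => /eqP qt0; rewrite -[RHS]qt0 horner_sum.
    by apply: eq_bigr => x _; rewrite hornerZ hornerXn.
  move=> x _; rewrite multinomial_pmfE mulrA -[RHS]mulrA; congr (_ * _).
  rewrite (eq_bigr (fun i : 'I_k.+1 =>
      t ^+ (n.+1 ^ i * val x i) / s ^+ val x i)).
    rewrite prodf_div !prodrXr (eqP (valP x)); congr (_ ^+ _ / _).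
    by apply: eq_bigr => i _; rewrite mulnC.
  by move=> i _; rewrite mxE monoE exprMn exprVn -exprM.
have q0 : q = 0.
  apply/eqP/negPn/negP => /(exists_nonroot)/(_ ltr01)[t /andP[t0 _]].
  by rewrite qt ?eqxx.
have /eqP : q`_(w y) = 0 by rewrite q0 coef0.
rewrite coef_sum (bigD1 y) //= big1 ?addr0 => [|x xy].
  rewrite coefZ coefXn eqxx mulr1 mulf_eq0 (gt_eqF (mult_gt0 _ _)) orbF.
  by move/eqP.
by rewrite coefZ coefXn (inj_eq w_inj) eq_sym (negbTE xy) mulr0.
Qed.

(** * The simplex and its projection *)

Lemma sum_drop_last (R : realType) j (x : 'rV[R]_j.+1) :
  \sum_i x 0 i = \sum_i drop_last x 0 i + x 0 ord_max.
Proof.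
rewrite big_ord_recr; congr (_ + _); apply: eq_bigr => i _.
by rewrite mxE; congr (x 0 _); exact: val_inj.
Qed.

Lemma flat_simplex_lift (R : realType) j (y : 'rV[R]_j) : flat_simplex R j y ->
  exists2 x : 'rV[R]_j.+1, simplex R j.+1 x & drop_last x = y.
Proof.
move=> [y0 y1]; pose x : 'rV[R]_j.+1 :=
  \row_i if unlift ord_max i is Some i' then y 0 i' else 1 - \sum_i y 0 i.
have xy : drop_last x = y.
  apply/rowP => i; rewrite !mxE.
  rewrite (_ : widen_ord _ i = lift ord_max i) ?liftK //.
  by apply: val_inj; rewrite /= /bump leqNgt ltn_ord.
exists x => //; split=> [i|].
  by rewrite mxE; case: unliftP => //= _; rewrite subr_ge0.
by rewrite sum_drop_last xy mxE unlift_none addrC subrK.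
Qed.

Lemma drop_last_segment (R : realType) k (x y : 'rV[R]_k) (t : R) :
  drop_last (x + t *: (y - x)) = drop_last x + t *: (drop_last y - drop_last x).
Proof. by apply/rowP => i; rewrite !mxE. Qed.

Lemma simplex_segment (R : realType) k (x y : 'rV[R]_k) (t : R) :
  simplex R k x -> simplex R k y -> 0 <= t <= 1 ->
  simplex R k (x + t *: (y - x)).
Proof.
move=> [x0 x1] [y0 y1] /andP[t0 t1].
have E i : (x + t *: (y - x)) 0 i = (1 - t) * x 0 i + t * y 0 i.
  by rewrite !mxE; ring.
split=> [i|]; first by rewrite E addr_ge0 // mulr_ge0 // subr_ge0.
under eq_bigr do rewrite E.
by rewrite big_split -!mulr_sumr /= x1 y1; ring.
Qed.

(** * Homogenization, and elimination of the last variable *)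

(** Each monomial is padded with powers of [sum_vars] rather than of one extra variable, which
    preserves the values on the simplex. The truncated subtraction is exact when [deg h <= n]. *)
Definition homogenize (R : realType) j n (h : mpoly j R) : mpoly j.+1 R :=
  \sum_(m <- msupp h) mcoeff m h *:
    (mpolyX R (mnmwiden m) * sum_vars R j.+1 ^+ (n - mdeg m)).

Lemma mdeg_mnmwiden j (m : multinom j) : mdeg (mnmwiden m) = mdeg m.
Proof.
rewrite !mdegE big_ord_recr /= mnmwiden_ordmax addn0.
by apply: eq_bigr => i _; rewrite mnmwiden_widen.
Qed.

Lemma homogenize_homog (R : realType) j n (h : mpoly j R) :
  (deg h <= n)%N -> homogenize n h \is ishomog1 n mdeg.
Proof.
move=> hn; rewrite /homogenize big_seq; apply: rpred_sum => m mh.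
apply: dhomogZ; have mn : (mdeg m <= n)%N.
  apply: leq_trans hn; have := msize_mdeg_lt mh; rewrite /deg.
  by case: (msize _).
rewrite -[X in ishomog1 X](subnKC mn); apply: dhomogM.
  by rewrite dhomogX /= mdeg_mnmwiden.
rewrite -[X in ishomog1 X]mul1n; apply: dhomogMn.
by apply: rpred_sum => i _; rewrite dhomogX /= mdeg1.
Qed.

Lemma evalv_homogenize (R : realType) j n (h : mpoly j R) (x : 'rV[R]_j.+1) :
  simplex R j.+1 x -> evalv (homogenize n h) x = evalv h (drop_last x).
Proof.
move=> sx; rewrite /evalv /homogenize raddf_sum [RHS]mevalE /=.
apply: eq_bigr => m _; rewrite mevalZ mevalM mevalX rmorphXn /=.
rewrite -[X in X ^+ (n - _)]/(evalv _ _) evalv_sum_vars // expr1n mulr1.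
rewrite big_ord_recr /= mnmwiden_ordmax mulr1; congr (_ * _).
apply: eq_bigr => i _; rewrite mnmwiden_widen mxE; congr (x 0 _ ^+ _).
exact: val_inj.
Qed.

Lemma deg_homog (R : realType) k n (p : mpoly k R) :
  p != 0 -> p \is ishomog1 n mdeg -> deg p = n.
Proof. by move=> p0 pn; apply: dhomog_uniq p0 (dhomog_msize pn) pn. Qed.

(** Eliminates the last variable through the equation of the simplex, landing in the ring that
    contains [f]. *)
Definition restrict (R : realType) j (p : mpoly j.+1 R) : mpoly j R :=
  comp_mpoly
    [tuple if unlift ord_max i is Some i' then mpolyX R (mnm1 i')
           else 1 - sum_vars R j | i < j.+1] p.

Lemma evalv_restrict (R : realType) j (p : mpoly j.+1 R) (x : 'rV[R]_j.+1) :
  simplex R j.+1 x -> evalv (restrict p) (drop_last x) = evalv p x.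
Proof.
move=> [_ x1]; rewrite /evalv comp_mpoly_meval; apply: meval_eq => i.
rewrite tnth_mktuple; case: unliftP => [i'|] ->.
  rewrite mevalXU mxE; congr (x 0 _); apply: val_inj.
  by rewrite /= /bump leqNgt ltn_ord.
rewrite mevalB meval1 meval_sum_vars.
by rewrite -x1 sum_drop_last addrAC subrr add0r.
Qed.

Lemma msizeM_leS (R : idomainType) k (p q : mpoly k R) a b :
  (msize p <= a.+1)%N -> (msize q <= b.+1)%N -> (msize (p * q) <= (a + b).+1)%N.
Proof.
have [->|p0] := eqVneq p 0; first by rewrite mul0r msize0.
have [->|q0] := eqVneq q 0; first by rewrite mulr0 msize0.
rewrite msizeM // => pa qb; rewrite -subn1 leq_subLR add1n -addnS -addSn.
exact: leq_add.
Qed.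

(** Every variable is replaced by a polynomial of degree at most 1. *)
Lemma deg_restrict (R : realType) j (p : mpoly j.+1 R) :
  (deg (restrict p) <= deg p)%N.
Proof.
suff : (msize (restrict p) <= (deg p).+1)%N by rewrite /deg; case: (msize _).
rewrite /restrict comp_mpolyEX.
apply: leq_trans (msize_sum _ _ _) _; apply/bigmax_leqP_seq => m mp _.
apply: leq_trans (msizeZ_le _ _) _.
have mp' : (mdeg m <= deg p)%N.
  by have := msize_mdeg_lt mp; rewrite /deg; case: (msize _).
apply: leq_trans (_ : _ <= (mdeg m).+1)%N _; last by rewrite ltnS.
rewrite comp_mpolyX mdegE.
apply: (big_ind2 (fun (q : mpoly j R) d => (msize q <= d.+1)%N)).
- by rewrite msize1.
- by move=> q a q' b; exact: msizeM_leS.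
move=> i _; rewrite tnth_mktuple; set q := (X in X ^+ _).
have q2 : (msize q <= 2)%N.
  rewrite /q; case: unlift => [i'|]; first by rewrite msizeX mdeg1.
  apply: leq_trans (msizeD_le _ _) _; rewrite msize1 msizeN geq_max /=.
  apply: leq_trans (msize_sum _ _ _) _; apply/bigmax_leqP_seq => l _ _.
  by rewrite msizeX mdeg1.
elim: (m i) => [|e IH]; first by rewrite expr0 msize1.
by rewrite exprS; exact: (@msizeM_leS _ _ _ _ 1 e).
Qed.

(** * Tests and their power polynomials *)

Definition power_mpoly (R : realType) k n (phi : test R k n) : mpoly k R :=
  \sum_x (val phi x * mult R k n x) *: mpolyX R (mono x).

Lemma evalv_power_mpoly (R : realType) k n (phi : test R k n) (v : 'rV[R]_k) :
  evalv (power_mpoly phi) v = power phi v.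
Proof.
rewrite /evalv raddf_sum; apply: eq_bigr => x _ /=.
by rewrite mevalZ mevalX -mulrA -multinomial_pmfE.
Qed.

Lemma deg_power_mpoly (R : realType) k n (phi : test R k n) :
  (deg (power_mpoly phi) <= n)%N.
Proof.
suff : (msize (power_mpoly phi) <= n.+1)%N by rewrite /deg; case: (msize _).
apply: leq_trans (msize_sum _ _ _) _; apply/bigmax_leqP_seq => x _ _.
by apply: leq_trans (msizeZ_le _ _) _; rewrite msizeX mdeg_mono.
Qed.

Lemma exists_test (R : realType) k n (d : sample k n -> R) :
  (forall x, 0 <= d x <= 1) -> exists phi : test R k n, val phi =1 d.
Proof.
move=> d01; pose phi : {ffun sample k n -> R} := [ffun x => d x].
have phiP : [forall x, 0 <= phi x <= 1] by apply/forallP => x; rewrite ffunE.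
by exists (exist _ phi phiP : test R k n) => x /=; rewrite ffunE.
Qed.

(** Linear independence of the multinomial probabilities. It turns equality of power functions into
    uniqueness of the most powerful test. *)
Lemma eq_test (R : realType) k n (phi psi : test R k.+1 n) :
  (forall p, simplex R k.+1 p -> power phi p = power psi p) -> phi = psi.
Proof.
move=> pq; apply: val_inj; apply/ffunP => x; apply/eqP; rewrite -subr_eq0.
apply/eqP; move: x.
apply: (@multinomial_pmf_free R k n (fun x => val phi x - val psi x)).
move=> v /pq/eqP; rewrite -subr_eq0 -sumrB => /eqP; apply: etrans.
by apply: eq_bigr => y _; rewrite mulrBl.
Qed.

Lemma testP (R : realType) k n (phi : test R k n) x : 0 <= val phi x <= 1.
Proof. exact: (forallP (valP phi)). Qed.

Lemma sum_multinomial_pmf (R : realType) k n (v : 'rV[R]_k.+1) :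
  simplex R k.+1 v -> \sum_x @multinomial_pmf R k.+1 n v x = 1.
Proof.
move=> sv; transitivity (evalv (sum_vars R k.+1 ^+ n) v); last first.
  by rewrite /evalv rmorphXn /= meval_sum_vars (proj2 sv) expr1n.
rewrite (@evalv_bernstein _ _ n).
  by apply: eq_bigr => x _; rewrite bernstein_sum_varsX mul1r.
apply/dhomogP; rewrite -[X in ishomog1 X]mul1n; apply: dhomogMn.
by apply: rpred_sum => i _; rewrite dhomogX /= mdeg1.
Qed.

(** For [c >= 0] the two bounds at [x] together say [c * g x <= 1], with [g x] the larger of
    [d x / (1 - a)] and [- d x / a]. So the largest [c] is the inverse of the maximum of [g], which
    is positive because some [d x] is nonzero, whatever its sign. *)
Lemma largest_scaling (R : realFieldType) (I : finType) (d : I -> R) (a : R) :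
  0 < a < 1 -> (exists x, d x != 0) ->
  exists2 ca, 0 < ca &
    forall c, 0 <= c -> (forall x, 0 <= c * d x + a <= 1) <-> c <= ca.
Proof.
move=> /andP[a0 a1] [x0 dx0]; have a1' : 0 < 1 - a by rewrite subr_gt0.
pose g x := Num.max (d x / (1 - a)) (- d x / a).
(* The default 0 does not alter the maximum, since some [g x] is positive. *)
pose M := \big[Num.max/0]_x g x.
have gM x : g x <= M by exact: (le_bigmax 0 g x).
have M0 : 0 < M.
  apply: lt_le_trans (gM x0); rewrite lt_max.
  case: (ltgtP (d x0) 0) dx0 => // dx _; last by rewrite divr_gt0.
  by rewrite orbC divr_gt0 ?oppr_gt0.
have cP c x : 0 <= c -> (0 <= c * d x + a <= 1) = (c * g x <= 1).
  move=> c0; rewrite maxr_pMr // ge_max !mulrA ler_pdivrMr // ler_pdivrMr //.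
  by rewrite !mul1r mulrN andbC lerBrDr lerNl -[- _ <= _]subr_ge0 opprK.
exists M^-1 => [|c c0]; first by rewrite invr_gt0.
rewrite -[X in _ <-> X]/(is_true _) -div1r ler_pdivlMr //; split=> [cd|cM x].
  rewrite /M; apply: (big_rec (fun y => c * y <= 1)) => [|x y _ IH].
    by rewrite mulr0.
  by rewrite maxr_pMr // ge_max IH -cP // cd.
by rewrite cP // (le_trans _ cM) // ler_wpM2l.
Qed.

(** * The null hypothesis as the zero set of f *)

Section NullHypothesis.
Variables (R : realType) (j : nat) (P0 : set 'rV[R]_j.+1) (f : mpoly j R).
Let V := [set drop_last p | p in P0].
Hypotheses (P0_nonempty : P0 !=set0) (P0_proper : P0 `<` simplex R j.+1).
Hypothesis P0_algebraic : algebraic P0.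
Hypothesis P0_closure : closure (interior (flat_simplex R j) `&` V) = V.
Hypothesis P0_ideal : vanishing_ideal V = principal_ideal f.
Hypothesis f_grad : forall p, P0 p -> grad f (drop_last p) != 0.

Lemma vanishing_multiple p : (forall x, P0 x -> evalv p (drop_last x) = 0) ->
  exists q, p = q * f.
Proof.
move=> p0; have : principal_ideal f p.
  by rewrite -P0_ideal => _ [x Px <-]; exact: p0.
by case=> q _ <-; exists q.
Qed.

Lemma P0_simplex x : P0 x -> simplex R j.+1 x.
Proof. exact: (proj1 P0_proper). Qed.

Lemma P0_zero x : P0 x -> evalv f (drop_last x) = 0.
Proof.
move=> Px; suff : vanishing_ideal V f by apply; exists x.
by rewrite P0_ideal; exists 1; rewrite ?mul1r.
Qed.

(** The equations defining [P0], once restricted, vanish on [P0] and are therefore multiples of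
    [f]. *)
Lemma zero_P0 x : simplex R j.+1 x -> evalv f (drop_last x) = 0 -> P0 x.
Proof.
case: P0_algebraic => s sE sx fx; rewrite sE; split=> // p ps.
have [y Py|q qE] := @vanishing_multiple (restrict p).
  have sy := P0_simplex Py; rewrite evalv_restrict //.
  by move: Py; rewrite sE => -[_]; exact.
by rewrite -evalv_restrict // qE /evalv mevalM -/(evalv f _) fx mulr0.
Qed.

Lemma alternativeP x : simplex R j.+1 x ->
  alternative P0 x <-> evalv f (drop_last x) != 0.
Proof.
move=> sx; split=> [[_ nPx]|fx]; first by apply/eqP => /(zero_P0 sx).
by split=> // /P0_zero /eqP; exact/negP.
Qed.

Lemma alternative_nonempty : exists x, alternative P0 x.
Proof.
have [_ /existsNP[x /not_implyP[sx nPx]]] := P0_proper.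
by exists x; split.
Qed.

Lemma f_neq0 : f != 0.
Proof.
have [x [sx nPx]] := alternative_nonempty.
apply: contra_notN nPx => /eqP f0; apply: zero_P0 => //.
by rewrite f0 /evalv meval0.
Qed.

(** The alternative is dense in the simplex: on the segment from [x] to a fixed point [y] of the
    alternative, [f] is a nonzero polynomial in the parameter, so points of the alternative
    accumulate at [x]. *)
Lemma ge0_on_simplex (p : mpoly j R) :
  (forall x, alternative P0 x -> 0 <= evalv p (drop_last x)) ->
  forall x, simplex R j.+1 x -> 0 <= evalv p (drop_last x).
Proof.
move=> p_ge0 x sx; have [y [sy nPy]] := alternative_nonempty.
have fy : evalv f (drop_last y) != 0 by apply/alternativeP.
set v := drop_last x; set w := drop_last y - v.
rewrite -[v]addr0 -(scale0r w) -horner_along.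
apply: (@horner0_ge0_off_roots _ _ (along v w f)) => [|t t01].
  (* At parameter 1 the segment reaches [y], where [f] is nonzero. *)
  apply: contraNneq fy => f0; rewrite -[drop_last y](subrK v) addrC -/w.
  by rewrite -[w]scale1r -horner_along f0 horner0.
have t01' : 0 <= t <= 1 by case/andP: t01 => /ltW ->.
rewrite !horner_along -drop_last_segment => ft; apply: p_ge0.
by apply/alternativeP => //; exact: simplex_segment.
Qed.

(** This step raises the multiplicity of [f] from one to two: [q] will be the quotient by [f] of the
    power minus the size. *)
Lemma vanishing_quotient (q : mpoly j R) :
  (forall x, simplex R j.+1 x -> 0 <= evalv (q * f) (drop_last x)) ->
  forall x, P0 x -> evalv q (drop_last x) = 0.
Proof.
move=> qf_ge0 x Px.
have Vx : closure (interior (flat_simplex R j) `&` V) (drop_last x).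
  by rewrite P0_closure; exists x.
(* The zeros of [q] form a closed set, so by [P0_closure] points interior to the flat simplex
   suffice. *)
have q_closed : closed [set y | evalv q y = 0].
  rewrite (_ : mkset _ = evalv q @^-1` [set 0]) //.
  apply: preimage_closed => [y _|]; first exact: evalv_continuous.
  exact: closed_eq.
apply: q_closed; move: Vx; apply: closure_subset => z [+ [y Py yz]].
rewrite -{z}yz => /nbhs_ballP[e /= e0 eP].
(* A single coordinate direction in which [f] has nonzero derivative is enough. *)
have [i] := rV0Pn _ (f_grad Py); rewrite mxE => fi.
have fy := P0_zero Py; set v := drop_last y in eP fi fy *.
suff : evalv (mderiv i (q * f)) v = 0.
  rewrite mderivM /evalv mevalD !mevalM -!/(evalv _ v) fy mulr0 add0r.
  by move/eqP; rewrite mulf_eq0 (negbTE fi) orbF => /eqP.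
rewrite -deriv_along; apply: (deriv0_local_min e0) => [|t te].
  by rewrite horner_along scale0r addr0 /evalv mevalM -!/(evalv _ v) fy mulr0.
rewrite horner_along.
(* A move of length below [e] stays in the ball, hence in the flat simplex, where [q * f] is
   nonnegative. *)
have [|z sz <-] := @flat_simplex_lift R j (v + t *: delta_mx 0 i).
  apply: eP; split=> // a b; rewrite -ball_normE /ball_ /= !mxE opprD addNKr.
  rewrite normrN normrM (le_lt_trans _ te) // ler_piMr //.
  by rewrite ger0_norm ?ler0n // lern1 leq_b1.
exact: qf_ge0.
Qed.

(** * Factorization of the power of an unbiased test *)

Section UnbiasedTest.
Variables (n : nat) (a : R) (phi : test R j.+1 n).
Hypotheses (phi_unbiased : unbiased P0 phi) (phi_size : of_size P0 a phi).

Lemma power_restrict x : simplex R j.+1 x ->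
  evalv (restrict (power_mpoly phi)) (drop_last x) = power phi x.
Proof. by move=> sx; rewrite evalv_restrict // evalv_power_mpoly. Qed.

(** By density of the alternative, the power at a point of [P0] is a lower bound on the whole
    simplex. Two points of [P0] thus bound each other, and the size is the supremum of a
    singleton. *)
Lemma power_P0 p : P0 p -> power phi p = a.
Proof.
have le_power p0 p1 : P0 p0 -> simplex R j.+1 p1 ->
    power phi p0 <= power phi p1.
  move=> Pp0 sp1; rewrite -subr_ge0 -(power_restrict sp1).
  have E x : simplex R j.+1 x -> evalv (restrict (power_mpoly phi) -
      mpolyC j (power phi p0)) (drop_last x) = power phi x - power phi p0.
    by move=> sx; rewrite -(power_restrict sx) /evalv mevalB mevalC.
  rewrite power_restrict // -E //; apply: ge0_on_simplex sp1 => x [sx nPx].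
  by rewrite E // subr_ge0; apply: phi_unbiased.
move=> Pp; rewrite -phi_size /size_of.
rewrite (_ : image _ _ = [set power phi p]) ?sup1 //.
apply/seteqP; split=> [_ [x Px <-] /=|_ ->]; last by exists p.
by apply/eqP; rewrite eq_le !le_power //; exact: P0_simplex.
Qed.

Lemma power_ge_size x : simplex R j.+1 x -> a <= power phi x.
Proof.
move=> sx; have [p0 Pp0] := P0_nonempty.
have [Px|nPx] := pselect (P0 x); first by rewrite power_P0.
by rewrite -(power_P0 Pp0); apply: phi_unbiased.
Qed.

Lemma power_factor : exists h : mpoly j R,
  [/\ restrict (power_mpoly phi) = h * f ^+ 2 + mpolyC j a,
      forall x, simplex R j.+1 x -> 0 <= evalv h (drop_last x) &
      forall x, simplex R j.+1 x ->
        power phi x = evalv f (drop_last x) ^+ 2 * evalv h (drop_last x) + a].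
Proof.
have [|q qE] := @vanishing_multiple (restrict (power_mpoly phi) - mpolyC j a).
  move=> x Px; rewrite /evalv mevalB mevalC -/(evalv _ (drop_last x)).
  by rewrite power_restrict ?power_P0 ?subrr //; exact: P0_simplex.
have qf_ge0 x : simplex R j.+1 x -> 0 <= evalv (q * f) (drop_last x).
  move=> sx; rewrite -qE /evalv mevalB mevalC -/(evalv _ (drop_last x)).
  by rewrite power_restrict // subr_ge0 power_ge_size.
(* Second division by [f]. *)
have [h hE] := vanishing_multiple (vanishing_quotient qf_ge0).
have E : restrict (power_mpoly phi) = h * f ^+ 2 + mpolyC j a.
  by rewrite expr2 mulrA -hE -qE subrK.
have powerE x : simplex R j.+1 x ->
    power phi x = evalv f (drop_last x) ^+ 2 * evalv h (drop_last x) + a.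
  move=> sx; rewrite -(power_restrict sx) E /evalv mevalD mevalM mevalC.
  by rewrite rmorphXn mulrC.
(* Off [P0] the factor [f ^+ 2] is positive and can be cancelled; density extends the sign of [h] to
   the simplex. *)
exists h; split=> // x sx; move: x sx; apply: ge0_on_simplex => x [sx nPx].
have : a <= power phi x by exact: power_ge_size.
rewrite powerE // lerDr pmulr_rge0 // lt0r sqr_ge0 andbT expf_neq0 //.
exact/alternativeP.
Qed.

Lemma NTUB_factor : NTUB P0 phi -> exists h : mpoly j R,
  [/\ h != 0, (deg h + 2 * deg f <= n)%N,
      forall x, simplex R j.+1 x -> 0 <= evalv h (drop_last x) &
      forall x, simplex R j.+1 x ->
        power phi x = evalv f (drop_last x) ^+ 2 * evalv h (drop_last x) + a].
Proof.
move=> [_ nconst]; have [h [hE h_ge0 powerE]] := power_factor.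
have h0 : h != 0.
  apply: contra_notN nconst => /eqP h0; exists a => x sx.
  by rewrite powerE // h0 /evalv meval0 mulr0 add0r.
exists h; split=> //; apply: leq_trans (deg_power_mpoly phi).
apply: leq_trans (deg_restrict _).
have f0 := f_neq0; have ff0 : f ^+ 2 != 0 by rewrite expf_neq0.
have -> : (deg h + 2 * deg f = deg (h * f ^+ 2)%R)%N.
  rewrite /deg expr2 in ff0 *; rewrite !msizeM //.
  move: h0 f0; rewrite -!msize_poly_eq0.
  case: (msize h) (msize f) => [//|b] [//|c] _ _.
  by rewrite addnS /= !addSn addnS /= mul2n addnn.
have -> : h * f ^+ 2 = restrict (power_mpoly phi) - mpolyC j a.
  by rewrite hE addrK.
(* Subtracting a constant does not raise [deg], which is 0 for every constant, zero included. *)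
rewrite /deg; set p := restrict _.
have := msizeD_le p (- mpolyC j a); rewrite msizeN msizeC.
by case: (a != 0); case: (msize p) => [|[|s]]; case: (msize _) => [|[|t]].
Qed.

(** Homogenizing the nonzero factor gives it degree exactly [n - 2 * deg f], where [NTUB_factor]
    only bounds the degree from above. *)
Lemma NTUB_factor_homogeneous : NTUB P0 phi -> exists h : mpoly j.+1 R,
  [/\ (deg h + 2 * deg f)%N = n,
      forall x, simplex R j.+1 x -> 0 <= evalv h x &
      forall x, simplex R j.+1 x ->
        power phi x = evalv f (drop_last x) ^+ 2 * evalv h x + a].
Proof.
move=> phiN; have [h [h0 hn h_ge0 powerE]] := NTUB_factor phiN.
pose H := homogenize (n - 2 * deg f) h.
have HE x : simplex R j.+1 x -> evalv H x = evalv h (drop_last x).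
  exact: evalv_homogenize.
have H0 : H != 0.
  apply: contra_notN (proj2 phiN) => /eqP H0; exists a => x sx.
  by rewrite powerE // -HE // H0 /evalv meval0 mulr0 add0r.
exists H; split=> [|x sx|x sx]; rewrite ?HE ?powerE ?h_ge0 //.
have degh : (deg h <= n - 2 * deg f)%N.
  by rewrite leq_subRL ?(leq_trans _ hn) ?leq_addl // addnC.
rewrite (deg_homog H0 (homogenize_homog degh)) subnK //.
by rewrite (leq_trans _ hn) ?leq_addl.
Qed.

End UnbiasedTest.

(** * Strict unbiasedness and the least sample size *)

Lemma SUB_NTUB n (phi : test R j.+1 n) : SUB P0 phi -> NTUB P0 phi.
Proof.
move=> phiS; split=> [p0 pA Pp0 pAA|[c constc]]; first exact/ltW/phiS.
have [p0 Pp0] := P0_nonempty; have [pA pAA] := alternative_nonempty.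
have := phiS _ _ Pp0 pAA.
by rewrite !constc ?ltxx //; [case: pAA|exact: P0_simplex].
Qed.

(** A zero of [g] in the alternative would bring the power down to [a], its value on [P0]. An
    arbitrary [g] is allowed because positivity is claimed for every factor, not only the
    constructed one. *)
Lemma SUB_factor_gt0 n a (phi : test R j.+1 n) (g : 'rV[R]_j.+1 -> R) :
  SUB P0 phi -> of_size P0 a phi ->
  (forall x, simplex R j.+1 x -> 0 <= g x) ->
  (forall x, simplex R j.+1 x ->
    power phi x = evalv f (drop_last x) ^+ 2 * g x + a) ->
  forall x, alternative P0 x -> 0 < g x.
Proof.
move=> phiS phia g_ge0 powerE x xA; have [sx _] := xA.
have [p0 Pp0] := P0_nonempty; have := phiS _ _ Pp0 xA.
rewrite (power_P0 (proj1 (SUB_NTUB phiS)) phia Pp0) powerE // ltrDr.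
move=> fg; rewrite lt0r g_ge0 // andbT.
by apply: contraTneq fg => ->; rewrite mulr0 ltxx.
Qed.

Lemma NTUB_sample_size n (phi : test R j.+1 n) :
  NTUB P0 phi -> (2 * deg f <= n)%N.
Proof.
move=> phiN; have [] := @NTUB_factor n (size_of P0 phi) phi _ _ phiN.
- by case: phiN.
- by [].
by move=> h [_ + _ _]; apply: leq_trans; exact: leq_addl.
Qed.

(** * Tests for sample size 2 deg f *)

Local Notation N := (2 * deg f)%N.

Definition coef_f2 : sample j.+1 N -> R := bernstein (homogenize N (f ^+ 2)).

Lemma deg_f2 : deg (f ^+ 2) = N.
Proof.
have := f_neq0; rewrite /deg expr2 => f0; rewrite msizeM //.
move: f0; rewrite -msize_poly_eq0; case: (msize f) => // b _.
by rewrite addnS addSn mul2n -addnn.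
Qed.

(** The probabilities sum to 1, so adding the constant [a] shifts every Bernstein coefficient by
    [a]. *)
Lemma scaled_f2_bernstein c a p : simplex R j.+1 p ->
  \sum_x (c * coef_f2 x + a) * multinomial_pmf p x =
  c * evalv f (drop_last p) ^+ 2 + a.
Proof.
move=> sp; under eq_bigr do rewrite mulrDl -mulrA.
rewrite big_split /= -!mulr_sumr sum_multinomial_pmf // mulr1.
congr (_ * _ + _).
rewrite -(@evalv_bernstein R _ N).
  by rewrite evalv_homogenize // /evalv rmorphXn.
by apply/dhomogP/homogenize_homog; rewrite deg_f2.
Qed.

Lemma coef_f2_neq0 : exists x, coef_f2 x != 0.
Proof.
apply/existsP; rewrite -[X in is_true X]negbK negb_exists.
apply/negP => /forallP c0.
have [p pA] := alternative_nonempty; have [sp _] := pA.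
have /eqP := scaled_f2_bernstein 1 0 sp; rewrite big1 => [|x _].
  by rewrite mul1r addr0 eq_sym sqrf_eq0; apply/negP/alternativeP.
by rewrite (eqP (negPn (c0 x))) mulr0 addr0 mul0r.
Qed.

(** Bernstein coefficients are unique, so [c * coef_f2 x + a] is the only candidate for the test. *)
Lemma power_polynomial_scaled c a :
  power_polynomial N (fun p : 'rV[R]_j.+1 =>
    c * evalv f (drop_last p) ^+ 2 + a) <->
  forall x, 0 <= c * coef_f2 x + a <= 1.
Proof.
split=> [[phi phiE] x|/exists_test[phi phiE]].
  suff <- : val phi x = c * coef_f2 x + a by exact: testP.
  apply/eqP; rewrite -subr_eq0; apply/eqP; move: x.
  apply: (@multinomial_pmf_free R j N
    (fun x => val phi x - (c * coef_f2 x + a))).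
  move=> v sv; rewrite -[RHS](subrr (power phi v)) -{2}phiE //.
  rewrite -scaled_f2_bernstein // -sumrB.
  by apply: eq_bigr => y _; rewrite mulrBl.
exists phi => p sp; rewrite -scaled_f2_bernstein //.
by apply: eq_bigr => x _; rewrite phiE.
Qed.

Lemma scaled_SUB n (phi : test R j.+1 n) c a : 0 < c ->
  (forall p, simplex R j.+1 p ->
    power phi p = c * evalv f (drop_last p) ^+ 2 + a) ->
  SUB P0 phi /\ of_size P0 a phi.
Proof.
move=> c0 powerE; have power0 p : P0 p -> power phi p = a.
  move=> Pp; rewrite powerE ?P0_zero ?expr0n ?mulr0 ?add0r //.
  exact: P0_simplex.
split=> [p0 pA Pp0 [spA nPpA]|].
  rewrite power0 // powerE // ltrDr mulr_gt0 // lt0r sqr_ge0 andbT expf_neq0 //.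
  exact/alternativeP.
rewrite /of_size /size_of /= (_ : image _ _ = [set a]) ?sup1 //.
have [p0 Pp0] := P0_nonempty.
apply/seteqP; split=> [_ [x Px <-] /=|_ ->]; first exact: power0.
by exists p0 => //; exact: power0.
Qed.

(** At this sample size the degree bound leaves only a constant for [h]; it is nonnegative and
    nonzero. *)
Lemma NTUB_scaled a (psi : test R j.+1 N) : NTUB P0 psi -> of_size P0 a psi ->
  exists2 c, 0 < c & forall p, simplex R j.+1 p ->
    power psi p = c * evalv f (drop_last p) ^+ 2 + a.
Proof.
move=> psiN psia.
have [h [h0 hN h_ge0 powerE]] := NTUB_factor (proj1 psiN) psia psiN.
have hC : h = mpolyC j (mcoeff mnm0 h).
  apply: msize1_polyC; move: hN; rewrite -{2}[N]add0n leq_add2r leqn0 /deg.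
  by case: (msize h) => [|[]].
have hE x : evalv h x = mcoeff mnm0 h.
  by rewrite hC /evalv mevalC mcoeffC eqxx mulr1.
exists (mcoeff mnm0 h) => [|p sp]; last by rewrite powerE // hE mulrC.
have [p0 /P0_simplex sp0] := P0_nonempty.
rewrite lt0r -{2}(hE (drop_last p0)) h_ge0 // andbT.
by apply: contraNneq h0 => c0; rewrite hC c0 mpolyC0.
Qed.

(** Powers in [C] differ only in the coefficient of [f ^+ 2], so the largest coefficient wins
    everywhere. One point of the alternative, where [f ^+ 2] is positive, forces any other winner to
    have coefficient [ca]. The class [C] is left open to cover both NTUB and SUB. *)
Lemma UMP_scaled a ca (C : set (test R j.+1 N)) (phi : test R j.+1 N) :
  C `<=` NTUB P0 `&` of_size P0 a -> C phi ->
  (forall p, simplex R j.+1 p ->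
    power phi p = ca * evalv f (drop_last p) ^+ 2 + a) ->
  (forall c, power_polynomial N (fun p : 'rV[R]_j.+1 =>
    c * evalv f (drop_last p) ^+ 2 + a) ->
    c <= ca) ->
  unique (UMP P0 C) phi.
Proof.
move=> CN Cphi phiE ca_max.
have CE psi : C psi -> exists2 c, c <= ca & forall p, simplex R j.+1 p ->
    power psi p = c * evalv f (drop_last p) ^+ 2 + a.
  move=> /CN[psiN psia]; have [c _ psiE] := NTUB_scaled psiN psia.
  by exists c => //; apply: ca_max; exists psi => p sp; rewrite psiE.
split=> [|psi [Cpsi psi_max]].
  split=> // psi /CE[c cca psiE] p [sp _].
  by rewrite psiE // phiE // lerD2r ler_wpM2r // sqr_ge0.
have [c cca psiE] := CE _ Cpsi; have [p pA] := alternative_nonempty.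
have [sp _] := pA; have := psi_max _ Cphi _ pA.
rewrite psiE // phiE // lerD2r ler_pM2r => [cac|]; last first.
  by rewrite lt0r sqr_ge0 andbT expf_neq0 //; apply/alternativeP.
have cE : c = ca by apply/eqP; rewrite eq_le cca.
by apply: eq_test => x sx; rewrite psiE // phiE // cE.
Qed.

Lemma exists_maximal_scaled_test a : 0 < a < 1 ->
  exists (phi : test R j.+1 N) (ca : R),
  [/\ 0 < ca,
      forall p, simplex R j.+1 p ->
        power phi p = ca * evalv f (drop_last p) ^+ 2 + a &
      forall c,
        power_polynomial N (fun p : 'rV[R]_j.+1 =>
    c * evalv f (drop_last p) ^+ 2 + a) ->
        c <= ca].
Proof.
move=> a01; have [ca ca0 caP] := largest_scaling a01 coef_f2_neq0.
have /power_polynomial_scaled[phi phiE] := proj2 (caP ca (ltW ca0)) (lexx ca).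
exists phi, ca; split=> // [p sp|c]; first by rewrite phiE.
(* [largest_scaling] speaks of [c >= 0] only; a negative [c] is below [ca] anyway. *)
have [c0 _|c0] := ltP c 0; first by rewrite ltW // (lt_trans c0).
by move/power_polynomial_scaled/(proj1 (caP c c0)).
Qed.

End NullHypothesis.

Theorem theorem5 (R : realType) (k : nat) (hk : (2 <= k)%N)
    (P0 : set 'rV[R]_k) (f : mpoly k.-1 R)
    (P0_nonempty : P0 !=set0) (P0_proper : P0 `<` simplex R k)
    (P0_algebraic : algebraic P0)
    (P0_closure :
       let V := [set drop_last p | p in P0] in
       closure (interior (flat_simplex R k.-1) `&` V) = V)
    (P0_ideal :
       vanishing_ideal [set drop_last p | p in P0] = principal_ideal f)
    (f_grad : forall p, P0 p -> grad f (drop_last p) != 0) :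
  [/\ NTUB_threshold P0 = Some (2 * deg f)%N /\
      SUB_threshold P0 = Some (2 * deg f)%N,
      forall a : R, 0 < a < 1 ->
        let n := (2 * deg f)%N in
        let b (c : R) (p : 'rV[R]_k) := c * evalv f (drop_last p) ^+ 2 + a in
        exists (phi : test R k n) (ca : R),
          [/\ unique (UMP P0 (NTUB P0 `&` of_size P0 a)) phi,
              unique (UMP P0 (SUB P0 `&` of_size P0 a)) phi,
              forall p, simplex R k p -> power phi p = b ca p,
              [/\ 0 < ca, power_polynomial n (b ca)
                & forall c, power_polynomial n (b c) -> c <= ca]
            & forall psi : test R k n, NTUB P0 psi -> of_size P0 a psi ->
                exists2 c : R, 0 < c <= ca &
                  forall p, simplex R k p -> power psi p = b c p]
    & forall (n : nat) (a : R) (phi : test R k n),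
        NTUB P0 phi -> of_size P0 a phi ->
        let factor (h : mpoly k R) :=
          [/\ (deg h + 2 * deg f)%N = n,
              forall p, simplex R k p -> 0 <= evalv h p
            & forall p, simplex R k p ->
                power phi p = evalv f (drop_last p) ^+ 2 * evalv h p + a] in
        (exists h, factor h) /\
        (SUB P0 phi -> forall h, factor h ->
           forall p, alternative P0 p -> 0 < evalv h p)].
Proof.
case: k hk P0 f P0_nonempty P0_proper P0_algebraic P0_closure P0_ideal f_grad
  => [//|j] _ P0 f P0n P0p P0a P0c P0i fg.
have maximal (a : R) := @exists_maximal_scaled_test _ _ _ _ P0p P0a P0i a.
have scaled n phi c a := @scaled_SUB _ _ _ _ P0n P0p P0a P0i n phi c a.
have SN n phi := @SUB_NTUB _ _ _ P0n P0p n phi.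
have min_size n phi := @NTUB_sample_size _ _ _ _ P0n P0p P0a P0c P0i fg n phi.
have [phi0 phi0S] : exists phi : test R j.+1 (2 * deg f), SUB P0 phi.
  (* Any size in the open unit interval would do; 1/2 is taken. *)
  have [|phi [ca [ca0 phiE _]]] := maximal 2^-1.
    by rewrite invr_gt0 ltr0n invf_lt1 ?ltr1n ?ltr0n.
  by exists phi; exact: (scaled _ _ _ _ ca0 phiE).1.
split.
- split; apply: min_sample_size_eq.
  + by exists phi0; exact: SN.
  + by move=> n [phi]; exact: min_size.
  + by exists phi0.
  + by move=> n [phi /SN]; exact: min_size.
- move=> a a01 n b; have [phi [ca [ca0 phiE ca_max]]] := maximal a a01.
  have [phiS phia] := scaled _ _ _ _ ca0 phiE.
  exists phi, ca; split=> //.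
  + apply: (UMP_scaled P0n P0p P0a P0c P0i fg _ _ phiE ca_max) => //.
    by split; [exact: SN|].
  + apply: (UMP_scaled P0n P0p P0a P0c P0i fg _ _ phiE ca_max) => //.
    by move=> psi [psiS psia]; split; [exact: SN|].
  + by split=> //; exists phi => p sp; rewrite phiE.
  + move=> psi psiN psia.
    have [c c0 psiE] := NTUB_scaled P0n P0p P0a P0c P0i fg psiN psia.
    exists c => //; rewrite c0; apply: ca_max; exists psi => p sp.
    by rewrite psiE.
- move=> n a phi phiN phia factor; split.
    exact: (NTUB_factor_homogeneous P0n P0p P0a P0c P0i fg phiN.1 phia phiN).
  move=> phiS h [_ h_ge0 powerE].
  exact: (SUB_factor_gt0 P0n P0p P0a P0i phiS phia h_ge0 powerE).
Qed.
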